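(* Let $d\ge 3$ and let $P=\mathrm{conv}\{A_0,\ldots,A_d\}$ be a cyclic polygon with circumcenter $M$ and circumradius $R$ in a normed plane $(\mathbb{R}^2,\|\cdot\|)$. For $i=0,\dots,d$ let $P_i=\mathrm{conv}(\{A_0,\ldots,A_d\}\setminus\{A_i\})$. (a) The Monge point $N_M$ of $P$ is the point of intersection of the lines $\langle A_iN_M^{i}\rangle$, $i=0,\ldots,d$, where $N_M^{i}$ is the Monge point of the subpolygon $P_i$ (with respect to $M$). (b) The centroids $G_i$ of the subpolygons $P_i$, $i=0,\ldots,d$, are concyclic on $S(F_M,\frac Rd)$, where $F_M$ is the $2(d+1)$-center of $P$. Furthermore, the circle $S(F_M,\frac Rd)$ passes through the $d+1$ points $L_i^M$ dividing the segments $[N_MA_i]$ in the ratio $1:(d-1)$, $i=0,\dots,d$. (c) The Monge points $N_M^{i}$ of the subpolygons, $i=0,\dots,d$, are concyclic on the circle $$S\left(M+\frac{1}{d-2}\sum_{j=0}^d(A_j-M),\ \frac{R}{d-2}\right)$$ with its center on the Euler line of $P$.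
   Context: A normed (Minkowski) plane $(\mathbb{R}^2,\|\cdot\|)$ is $\mathbb{R}^2$ with an arbitrary norm; $S(X,r)=\{Y:\|Y-X\|=r\}$. A cyclic polygon $P=\mathrm{conv}\{A_0,\ldots,A_d\}$ is a convex polygon whose (pairwise distinct) vertices $A_0,\dots,A_d$ all lie on some circle $S(M,R)$, $R>0$; then $M$ is called a circumcenter and $R$ the corresponding circumradius of $P$. The point $M$ is then also a circumcenter of each subpolygon $P_i$. $\langle XY\rangle$ is the line through two distinct points $X,Y$, and $[XY]$ the closed segment; in (a) only those indices $i$ with $A_i\ne N_M^i$, for which the line is well-defined, are considered. A point $X$ divides $[AB]$ in the ratio $p:q$ if $X=A+\frac{p}{p+q}(B-A)$. For the polygon $P$ with $d+1$ vertices $A_0,\ldots,A_d$ and circumcenter $M$: the centroid is $G=\frac{1}{d+1}\sum_{i=0}^dA_i$; the $2(d+1)$-center is $F_M=M+\frac1d\sum_{i=0}^d(A_i-M)$; the Monge point is $N_M=M+\frac1{d-1}\sum_{i=0}^d(A_i-M)$. The same definitions apply to the subpolygons $P_i$, which have $d$ vertices (also when $d=3$ and $P_i$ is a triangle): $G_i=\frac1d\sum_{j\ne i}A_j$ and $N_M^i=M+\frac{1}{d-2}\sum_{j\neq i}(A_j-M)$. The Euler line of $P$ is the line $\langle MG\rangle$ when $M\ne G$; when $M=G$ it is not well-defined (''collapses'' to the point $M$), and being ''on the Euler line'' then means coinciding with $M$. *)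

(* Defs.v *)
From mathcomp Require Import all_boot all_order all_algebra.
From mathcomp Require Import classical_sets reals convex.

Set Implicit Arguments.
Unset Strict Implicit.
Unset Printing Implicit Defensive.

Import Order.TTheory GRing.Theory Num.Theory.

Local Open Scope classical_set_scope.
Local Open Scope ring_scope.

(* The plane is 'rV[R]_2 with an arbitrary norm [nrm] passed explicitly; the
   library's canonical (sup) norm `|_| on row vectors is never used. *)
Record is_norm (R : realType) (nrm : 'rV[R]_2 -> R) : Prop := IsNorm {
  norm_triangle : forall x y, nrm (x + y) <= nrm x + nrm y ;
  norm_scale : forall (a : R) x, nrm (a *: x) = `|a| * nrm x ;
  norm_definite : forall x, nrm x = 0 -> x = 0 }.

Definition circle (R : realType) (nrm : 'rV[R]_2 -> R) (X : 'rV[R]_2) (r : R)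
    : set 'rV[R]_2 :=
  [set Y | nrm (Y - X) = r].

(* Only meaningful for X <> Y. *)
Definition line (R : realType) (X Y : 'rV[R]_2) : set 'rV[R]_2 :=
  [set Z | exists t : R, Z = X + t *: (Y - X)].

Definition divide (R : realType) (A B : 'rV[R]_2) (p q : R) : 'rV[R]_2 :=
  A + (p / (p + q)) *: (B - A).

Definition conv_hull (R : realType) (S : set 'rV[R]_2) : set 'rV[R]_2 :=
  smallest (@convex_set R 'rV[R]_2) S.

Definition extreme_points (R : realType) (K : set 'rV[R]_2) : set 'rV[R]_2 :=
  [set x | K x /\ forall (y z : 'rV[R]_2) (t : R),
     K y -> K z -> 0 < t < 1 -> x = (1 - t) *: y + t *: z -> y = x /\ z = x].

(* The vertices of a convex polygon are its extreme points.  The A i need not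
   be listed in cyclic order.  For n >= 3 the hull cannot degenerate to a
   segment, as a segment has at most two extreme points. *)
Definition convex_polygon (R : realType) (n : nat) (A : 'I_n -> 'rV[R]_2)
    : Prop :=
  injective A /\ extreme_points (conv_hull (range A)) = range A.

Definition cyclic_polygon (R : realType) (nrm : 'rV[R]_2 -> R) (n : nat)
    (A : 'I_n -> 'rV[R]_2) (M : 'rV[R]_2) (r : R) : Prop :=
  [/\ convex_polygon A, 0 < r & forall i, circle nrm M r (A i)].

(* The following three are indexed by the number n of vertices, so a polygon
   with vertices A_0, ..., A_d has n = d + 1 and its subpolygons have n = d. *)
Definition centroid (R : realType) (n : nat) (A : 'I_n -> 'rV[R]_2)
    : 'rV[R]_2 :=
  n%:R^-1 *: \sum_(i < n) A i.

(* The "2n-center" F_M. *)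
Definition double_center (R : realType) (n : nat) (A : 'I_n -> 'rV[R]_2)
    (M : 'rV[R]_2) : 'rV[R]_2 :=
  M + (n%:R - 1)^-1 *: \sum_(i < n) (A i - M).

Definition monge_point (R : realType) (n : nat) (A : 'I_n -> 'rV[R]_2)
    (M : 'rV[R]_2) : 'rV[R]_2 :=
  M + (n%:R - 2)^-1 *: \sum_(i < n) (A i - M).

(* The vertices of the subpolygon obtained by deleting A i. *)
Definition subpolygon (R : realType) (d : nat) (A : 'I_d.+1 -> 'rV[R]_2)
    (i : 'I_d.+1) : 'I_d -> 'rV[R]_2 :=
  fun j => A (lift i j).

Definition euler_line (R : realType) (n : nat) (A : 'I_n -> 'rV[R]_2)
    (M : 'rV[R]_2) : set 'rV[R]_2 :=
  if M == centroid A then [set M] else line M (centroid A).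

(* Main.v *)
Require Import Defs.
From mathcomp Require Import all_boot all_order all_algebra.
From mathcomp Require Import classical_sets reals.
From mathcomp Require Import ring lra.

Import Order.TTheory GRing.Theory Num.Theory.

Local Open Scope classical_set_scope.
Local Open Scope ring_scope.

(** Put [S := \sum_j (A j - M)].  Every center of the polygon has the form
[M + c *: S], and deleting [A i] replaces [S] by [S - (A i - M)].  Hence the
points of (b) and (c) differ from the claimed centers by a fixed multiple of
[A i - M], a vector of norm [r]: the multiples are [- 1/d] for the centroids,
[1/d] for the division points and [- 1/(d-2)] for the Monge points of the
subpolygons; homogeneity of the norm gives the radii.  The center in (c) is on
the Euler line because [centroid A - M] is also a multiple of [S].

For (a), the Monge point [N] of the polygon satisfies
[N^i - A i = (d-1)/(d-2) *: (N - A i)] ([monge_subpolygon_sub]), so the line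
through [A i] and [N^i] passes through [N], and it is well defined exactly when
[A i] is not [N].  If all these lines shared a second point [Z], then all
vertices, including one possibly equal to [N], would be on the line through
[N] and [Z].  Circles of a norm can contain segments, so concyclicity does not
forbid this; what does is that the vertices are extreme points of their hull
([convex_polygon_not_collinear]). *)

(** * Sums over the vertices *)

Lemma sum_subpolygon_sub (R : realType) (d : nat)
    (A : 'I_d.+1 -> 'rV[R]_2) (M : 'rV[R]_2) i :
  \sum_(j < d) (subpolygon A i j - M)
  = \sum_(j < d.+1) (A j - M) - (A i - M).
Proof. by rewrite (bigD1_ord i) //= [RHS]addrC addKr. Qed.

Lemma centroid_sub (R : realType) (n : nat) (A : 'I_n.+1 -> 'rV[R]_2)
    (M : 'rV[R]_2) :
  centroid A - M = n.+1%:R^-1 *: \sum_(j < n.+1) (A j - M).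
Proof.
rewrite /centroid big_split /= sumr_const card_ord scalerDr; congr (_ + _).
by rewrite -scaler_nat scalerA mulVf ?scale1r // pnatr_eq0.
Qed.

(** * The Monge points of the subpolygons *)

Lemma monge_subpolygon_sub (R : realType) (d : nat)
    (A : 'I_d.+1 -> 'rV[R]_2) (M : 'rV[R]_2) i :
  (3 <= d)%N ->
  monge_point (subpolygon A i) M - A i
  = ((d%:R - 1) / (d%:R - 2)) *: (monge_point A M - A i).
Proof.
move=> d_ge3; have d_ge3R : 3 <= d%:R :> R by rewrite ler_nat.
rewrite /monge_point sum_subpolygon_sub.
set S := \sum_(j < d.+1) _.
apply/rowP => k; rewrite !mxE -natr1; field.
by apply/andP; split; apply/eqP; lra.
Qed.

Lemma monge_point_on_line (R : realType) (d : nat)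
    (A : 'I_d.+1 -> 'rV[R]_2) (M : 'rV[R]_2) i :
  (3 <= d)%N ->
  line (A i) (monge_point (subpolygon A i) M) (monge_point A M).
Proof.
move=> d_ge3; have d_ge3R : 3 <= d%:R :> R by rewrite ler_nat.
exists ((d%:R - 2) / (d%:R - 1)).
rewrite monge_subpolygon_sub // scalerA mulrA divfK; last by apply/eqP; lra.
by rewrite divff ?scale1r ?subrKC //; apply/eqP; lra.
Qed.

(** * Convex polygons are not collinear *)

Lemma vertex_not_between (R : realType) (n : nat) (A : 'I_n -> 'rV[R]_2)
    (X V : 'rV[R]_2) (t : 'I_n -> R) i j k :
  convex_polygon A -> (forall l, A l = X + t l *: V) ->
  t i < t j -> t j < t k -> False.
Proof.
move=> [injA extA] AE ltij ltjk.
have hullA l : conv_hull (range A) (A l).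
  by move=> B [_ subB]; apply: subB; exists l.
have [_ extAj] : extreme_points (conv_hull (range A)) (A j).
  by rewrite extA; exists j.
have Aij : A i = A j.
  pose s := (t j - t i) / (t k - t i).
  apply: (extAj (A i) (A k) s (hullA i) (hullA k) _ _).1.
    by rewrite divr_gt0 ?ltr_pdivrMr ?mul1r //=; lra.
  rewrite !AE /s; apply/rowP => l; rewrite !mxE; field.
  by apply/eqP; lra.
by move: ltij; rewrite (injA _ _ Aij) ltxx.
Qed.

(** Among three distinct points of a line, one is strictly between the two
others, so it is not an extreme point of a set containing them. *)
Lemma convex_polygon_not_collinear (R : realType) (n : nat)
    (A : 'I_n -> 'rV[R]_2) (X V : 'rV[R]_2) :
  (3 <= n)%N -> convex_polygon A ->
  ~ (forall i, exists t : R, A i = X + t *: V).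
Proof.
case: n A => [|[|[|n]]] // A _ convA /boolp.choice[t AE].
have t_neq i j : i != j -> t i != t j.
  apply: contra_neq => tij; apply: convA.1.
  by rewrite !AE tij.
pose i0 : 'I_n.+3 := inord 0; pose i1 : 'I_n.+3 := inord 1.
pose i2 : 'I_n.+3 := inord 2.
have between := vertex_not_between _ _ _ _ _ _ _ _ _ convA AE.
have t01 : t i0 != t i1 by apply: t_neq; rewrite -val_eqE /= !inordK.
have t12 : t i1 != t i2 by apply: t_neq; rewrite -val_eqE /= !inordK.
have t02 : t i0 != t i2 by apply: t_neq; rewrite -val_eqE /= !inordK.
case: (ltgtP (t i0) (t i1)) t01 => // lt01 _;
  case: (ltgtP (t i1) (t i2)) t12 => // lt12 _;
  case: (ltgtP (t i0) (t i2)) t02 => // lt02 _; eauto.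
all: lra.
Qed.

(** * Points of a circle *)

Lemma circle_scale (R : realType) (nrm : 'rV[R]_2 -> R) (M X : 'rV[R]_2)
    (r c : R) (C Y : 'rV[R]_2) :
  is_norm nrm -> circle nrm M r X -> Y - C = c *: (X - M) ->
  circle nrm C (`|c| * r) Y.
Proof.
by move=> nrm_norm circX YC; rewrite /circle /= YC norm_scale // circX.
Qed.

Theorem theorem5p2 (R : realType) (nrm : 'rV[R]_2 -> R) (d : nat)
    (A : 'I_d.+1 -> 'rV[R]_2) (M : 'rV[R]_2) (r : R)
    (nrm_norm : is_norm nrm) (d_ge3 : (3 <= d)%N)
    (cyclicP : cyclic_polygon nrm A M r) :
  [/\ (* (a) *)
      \bigcap_(i in [set i | A i <> monge_point (subpolygon A i) M])
        line (A i) (monge_point (subpolygon A i) M)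
      = [set monge_point A M],
      (* (b) *)
      (forall i, circle nrm (double_center A M) (r / d%:R)
                   (centroid (subpolygon A i)))
      /\
      (forall i, circle nrm (double_center A M) (r / d%:R)
                   (divide (monge_point A M) (A i) 1 (d%:R - 1))) &
      (* (c) *)
      let C := M + (d%:R - 2)^-1 *: \sum_(j < d.+1) (A j - M) in
      (forall i, circle nrm C (r / (d%:R - 2))
                   (monge_point (subpolygon A i) M))
      /\ euler_line A M C].
Proof.
have d_ge3R : 3 <= d%:R :> R by rewrite ler_nat.
have [convA r_gt0 circA] := cyclicP.
have normV (c : R) : 0 < c -> r / c = `|c^-1| * r.
  by move=> c_gt0; rewrite gtr0_norm ?invr_gt0 // mulrC.
have normNV (c : R) : 0 < c -> r / c = `|- c^-1| * r.
  by move=> c_gt0; rewrite normrN normV.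
split=> [||C].
- apply/seteqP; split=> [Z Zlines | _ -> i _]; last exact: monge_point_on_line.
  set N := monge_point A M in Zlines *.
  apply/eqP/negPn/negP => ZN.
  apply: (convex_polygon_not_collinear _ _ A N (Z - N) (ltnW d_ge3) convA) => i.
  have [AiN|/eqP AiN] := eqVneq (A i) N.
    by exists 0; rewrite scale0r addr0.
  have Ai_monge : A i <> monge_point (subpolygon A i) M.
    move=> /esym/eqP; rewrite -subr_eq0 monge_subpolygon_sub // scaler_eq0.
    rewrite subr_eq0 => /orP[/eqP|/eqP/esym//].
    by apply/eqP; rewrite mulf_neq0 ?invr_neq0 //; apply/eqP; lra.
  have [s ZE] := Zlines i Ai_monge.
  rewrite monge_subpolygon_sub // scalerA in ZE.
  move: ZE; set s' := s * _ => ZE.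
  have ZNE : Z - N = (1 - s') *: (A i - N).
    by rewrite ZE -/N; apply/rowP => k; rewrite !mxE; ring.
  have s'_neq1 : 1 - s' != 0.
    by apply: contra_neq ZN => s0; apply/subr0_eq; rewrite ZNE s0 scale0r.
  by exists (1 - s')^-1; rewrite ZNE scalerK // subrKC.
- split=> i.
  + rewrite normNV; last lra.
    apply: (circle_scale _ _ M (A i)) => //.
    have -> : centroid (subpolygon A i) - double_center A M
        = (centroid (subpolygon A i) - M) - (double_center A M - M).
      by rewrite opprB addrA subrK.
    case: d d_ge3 d_ge3R A {cyclicP convA circA} i
      => [//|d] _ d_ge3R A i.
    rewrite centroid_sub sum_subpolygon_sub /double_center.
    set S := \sum_(j < d.+2) _.
    apply/rowP => k; rewrite !mxE -(natr1 d.+1); field.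
    by apply/eqP; lra.
  + rewrite normV; last lra.
    apply: (circle_scale _ _ M (A i)) => //.
    rewrite /divide /monge_point /double_center.
    set S := \sum_(j < d.+1) _.
    apply/rowP => k; rewrite !mxE -(natr1 d); field.
    by do ?[apply/andP; split]; apply/eqP; lra.
- split=> [i|].
    rewrite normNV; last lra.
    apply: (circle_scale _ _ M (A i)) => //.
    rewrite /monge_point sum_subpolygon_sub /C.
    set S := \sum_(j < d.+1) _.
    apply/rowP => k; rewrite !mxE; field.
    by apply/eqP; lra.
  have CE : C = M + (d.+1%:R / (d%:R - 2)) *: (centroid A - M).
    by rewrite centroid_sub scalerA mulrAC divff ?mul1r // pnatr_eq0.
  rewrite /euler_line; case: eqP => [MG | _].
    by rewrite /= CE -MG subrr scaler0 addr0.
  by exists (d.+1%:R / (d%:R - 2)).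
Qed.
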